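(* There exists a universal constant $c(n,k)$ such that, given any system of inequalities $\{x\in\mathbb{R}^n : Ax\le b\}$, if every subset of the constraints of cardinality $c(n,k)$ has more than $k$ integer solutions, then the entire system of inequalities must have more than $k$ integer solutions.
   Context: Here $n$ and $k$ are non-negative integers, and ''universal'' means that the constant $c(n,k)$ depends only on $n$ and $k$. $A$ is a real matrix with $m$ rows and $n$ columns, $b\in\mathbb{R}^m$, and the constraints are the $m$ linear inequalities given by the rows of $Ax\le b$. An integer solution of a set of constraints is a point of $\mathbb{Z}^n$ satisfying all of them.
   Formalization: When the system has fewer than c(n,k) constraints, no subset of that cardinality exists and the claim read literally fails (e.g. the single constraint 0 ≤ -1); in that case the hypothesis is imposed on the whole system instead. *)

(* Defs.v *)
From mathcomp Require Import all_boot all_order all_algebra.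
From mathcomp Require Import boolp classical_sets functions cardinality reals.

Set Implicit Arguments.
Unset Strict Implicit.
Unset Printing Implicit Defensive.

Import Order.TTheory GRing.Theory Num.Theory.

Local Open Scope classical_set_scope.
Local Open Scope ring_scope.

(* The subsystem of A x <= b made of the rows with index in S. Constraints are
   identified with their row indices, so that repeated rows count separately. *)
Definition integer_solutions (R : realType) (m n : nat) (A : 'M[R]_(m, n))
    (b : 'cV[R]_m) (S : {set 'I_m}) : set 'cV[int]_n :=
  [set x | forall i : 'I_m, i \in S ->
     (A *m map_mx (intr : int -> R) x) i 0 <= b i 0].

(* A cardinality strictly larger than k; X may be infinite. *)
Definition more_than (T : Type) (k : nat) (X : set T) : Prop :=
  (`I_k.+1 #<= X)%card.

(* Main.v *)
Require Import Defs.
From mathcomp Require Import all_boot all_order all_algebra.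
From mathcomp Require Import boolp classical_sets functions cardinality reals.
From mathcomp Require Import zify ring.

(** Doignon's parity argument, with residues modulo k + 2 in place of parities,
    gives c = (k + 2) ^ n.

    If the whole system has at most k integer solutions, a subsystem S minimal
    with this property has at most k solutions as well, but strictly more
    without any one of its rows. It is enough to bound the size of such an S
    ([card_minimal_system]). Finitely many lattice points witness the minimality
    of S; work in a finite box of lattice points that contains them. Inside the
    box, push every right-hand side outwards as far as possible while at most k
    points satisfy all the constraints strictly. Every row i then has a point
    z i on its own boundary that satisfies all the other constraints strictly
    ([exists_private_points]).

    If S has more than (k + 2) ^ n rows, two of these points, z i and z j, agree
    coordinatewise modulo k + 2. They are distinct, so the segment between them
    is cut by k + 1 lattice points into k + 2 equal parts
    ([lattice_points_on_segment]). Each of these k + 1 points is a proper convex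
    combination of z i and z j, and every constraint is satisfied weakly by both
    ends and strictly by at least one of them; so k + 1 points of the box
    satisfy all the pushed constraints strictly, a contradiction. *)

Set Implicit Arguments.
Unset Strict Implicit.
Unset Printing Implicit Defensive.

Import Order.TTheory GRing.Theory Num.Theory.

Lemma more_thanP (T : eqType) (k : nat) (X : set T) :
  more_than k X <->
  exists g : 'I_k.+1 -> T, injective g /\ forall t, X (g t).
Proof.
split=> [/pcard_surjP[r r_surj] | [g [g_inj gX]]].
  have /fin_all_exists[g gP] (t : 'I_k.+1) : exists x, X x /\ r x = t.
    by have [x Xx rx] := r_surj (val t) (ltn_ord t); exists x.
  exists g; split=> [s t est | t]; last by case: (gP t).
  by apply: val_inj; have [_ /= <-] := gP s; have [_ /= <-] := gP t; rewrite est.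
apply/pcard_surjP.
(* Cardinality here is compared by surjections; points outside the image of g
   are sent to 0, an arbitrary value. *)
exists (fun x => if [pick t | g t == x] is Some t then val t else 0).
move=> s lt_s; exists (g (Ordinal lt_s)) => //.
by case: pickP => [t /eqP/g_inj-> // | /(_ (Ordinal lt_s))]; rewrite eqxx.
Qed.

Lemma card_gtP (F : finType) (k : nat) (X : {set F}) :
  k < #|X| <-> exists g : 'I_k.+1 -> F, injective g /\ forall t, g t \in X.
Proof.
split=> [lt_kX | [g [g_inj gX]]].
  exists (fun t => enum_val (widen_ord lt_kX t)); split=> [s t | t].
    by move=> /enum_val_inj /(congr1 val) /= /val_inj.
  exact: enum_valP.
rewrite -[k.+1]card_ord -(card_codom g_inj); apply: subset_leq_card.
by apply/fintype.subsetP=> _ /codomP[t ->].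
Qed.

Lemma leq_card_imply (F : finType) (P Q : pred F) :
  (forall x, P x -> Q x) -> #|[set x | P x]| <= #|[set x | Q x]|.
Proof.
by move=> PQ; apply/subset_leq_card/fintype.subsetP=> x; rewrite !inE; apply: PQ.
Qed.

Lemma exists_superset_card (F : finType) (S : {set F}) (c : nat) :
  #|S| <= c -> c <= #|F| -> exists2 T : {set F}, S \subset T & #|T| = c.
Proof.
move=> le_Sc le_cF.
have /card_geqP[s [s_uniq size_s sC]] : c - #|S| <= #|~: S|.
  by rewrite leq_subLR cardsC.
exists (S :|: [set x in s]); first exact: finset.subsetUl.
rewrite cardsU cardsE (card_uniqP s_uniq) size_s subnKC //.
suff -> : S :&: [set x in s] = finset.set0 by rewrite cards0 subn0.
apply/setP=> x; rewrite !inE; apply/andP=> -[Sx /sC].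
by rewrite inE Sx.
Qed.

Lemma exists_least (R : realDomainType) (F : finType) (P : pred F)
    (h : F -> R) :
  (exists x, P x) -> exists2 x, P x & forall y, P y -> (h x <= h y)%R.
Proof.
case=> x0 Px0; case: (arg_minP h Px0) => x Px x_min.
by exists x.
Qed.

(** The right-hand sides are pushed outwards here. The new ones are sought among
    the values f i (p i) with p i in F: this leaves finitely many candidates p,
    and those for which at most k points satisfy all the constraints strictly
    can be compared by the sum of their right-hand sides. For an optimal p, the
    constraints other than i have more than k common points, so one of them
    violates the strict constraint i. The one with the least value of f i can
    replace p i without adding any point to the strict system; optimality
    therefore puts it exactly on the boundary of constraint i. *)
Lemma exists_private_points (R : realDomainType) (I F : finType) (k : nat)
    (f : I -> F -> R) (b : I -> R) :
  #|[set x | [forall i, (f i x <= b i)%R]]| <= k ->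
  (forall i, k < #|[set x | [forall (j | j != i), (f j x <= b j)%R]]|) ->
  exists z : I -> F,
    #|[set x | [forall i, (f i x < f i (z i))%R]]| <= k /\
    forall i j, j != i -> (f j (z i) < f j (z j))%R.
Proof.
move=> le_k gt_k.
pose below (p : {ffun I -> F}) := [set x | [forall i, (f i x < f i (p i))%R]].
pose admissible (p : {ffun I -> F}) :=
  (#|below p| <= k) && [forall i, (b i < f i (p i))%R].
have [p0 adm0] : exists p, admissible p.
  (* A least value of f i above b i makes f i x < f i (p i) say f i x <= b i. *)
  have /fin_all_exists2[p p_gt p_min] i : exists2 x, (b i < f i x)%R &
      forall y, (b i < f i y)%R -> (f i x <= f i y)%R.
    apply: exists_least; apply: contrapT => none.
    have: k < k.
      apply: leq_trans (gt_k i) _; apply: leq_trans le_k.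
      apply: leq_card_imply => x /forall_inP lex; apply/forallP=> j.
      have [->|/lex//] := eqVneq j i.
      by rewrite leNgt; apply/negP=> lt; apply: none; exists x.
    by rewrite ltnn.
  exists (finfun p); apply/andP; split; last by apply/forallP=> i; rewrite ffunE.
  apply: leq_trans le_k; apply: leq_card_imply => x /forallP lex.
  apply/forallP=> i; move: (lex i).
  by rewrite ffunE leNgt => lt; apply: contraL lt => /p_min; rewrite -leNgt.
case: (arg_maxP (fun p : {ffun I -> F} => (\sum_i f i (p i))%R) adm0) => p.
case/andP=> le_p /forallP b_lt p_max.
have /fin_all_exists[z zP] i : exists x, f i x = f i (p i) /\
    forall j, j != i -> (f j x < f j (p j))%R.
  pose Q x := [forall (j | j != i), (f j x < f j (p j))%R]
              && (f i (p i) <= f i x)%R.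
  have [|x /andP[/forall_inP ltx le_px] x_min] := @exists_least _ _ Q (f i).
    apply: contrapT => none.
    have: k < k.
      apply: leq_trans (gt_k i) _; apply: leq_trans le_p.
      apply: leq_card_imply => x /forall_inP lex.
      have ltx j : j != i -> (f j x < f j (p j))%R.
        by move=> /lex /le_lt_trans; apply.
      apply/forallP=> j; have [->|/ltx//] := eqVneq j i.
      rewrite ltNge; apply/negP=> le; apply: none; exists x.
      by apply/andP; split=> //; apply/forall_inP.
    by rewrite ltnn.
  exists x; split=> //; apply/eqP; rewrite eq_le le_px andbT.
  pose q := [ffun j => if j == i then x else p j].
  have /p_max : admissible q.
    apply/andP; split; last first.
      apply/forallP=> j; rewrite ffunE; case: eqP => [->|//].
      exact: lt_le_trans (b_lt i) le_px.
    apply: leq_trans le_p; apply: leq_card_imply => y /forallP lty.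
    apply/forallP=> j.
    have lty' l : l != i -> (f l y < f l (p l))%R.
      by move=> /negPf nli; have:= lty l; rewrite ffunE nli.
    have [->|/lty'//] := eqVneq j i.
    rewrite ltNge; apply/negP=> le_py.
    have /x_min : Q y by apply/andP; split=> //; apply/forall_inP.
    by apply/negP; rewrite -ltNge; have:= lty i; rewrite ffunE eqxx.
  rewrite /Order.ge /= (bigD1 i) //= [leRHS](bigD1 i) //= ffunE eqxx.
  rewrite (eq_bigr (fun j => f j (p j))) ?lerD2r //.
  by move=> j /negPf nji; rewrite ffunE nji.
exists z; split=> [|i j nji]; last by rewrite (zP j).1; apply: (zP i).2.
apply: leq_trans le_p; apply: leq_card_imply => x.
by move=> /forallP ltx; apply/forallP=> i; rewrite -(zP i).1.
Qed.

(** Congruence modulo q makes (q - t) * x + t * y divisible by q. Coordinates are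
    natural numbers below M, which keeps the points inside the box. *)
Lemma lattice_points_on_segment (n M q t : nat) (x y : 'cV['I_M]_n) :
  0 < q -> t <= q -> (forall i, x i ord0 = y i ord0 %[mod q]) ->
  exists w : 'cV['I_M]_n, forall i,
    q * w i ord0 = (q - t) * x i ord0 + t * y i ord0.
Proof.
move=> q_gt0 le_tq congr_xy.
have /fin_all_exists[w wP] i : exists w : 'I_M,
    q * w = (q - t) * x i ord0 + t * y i ord0.
  have /dvdnP[w ew] : q %| (q - t) * x i ord0 + t * y i ord0.
    rewrite /dvdn -modnDm -modnMmr congr_xy modnMmr modnDm.
    by rewrite -mulnDl subnK // modnMr.
  have lt_wM : w < M.
    case: M x y {congr_xy} ew => [|M] x y ew; first by case: (x i ord0).
    rewrite ltnS -(leq_pmul2r q_gt0) -ew [M * q]mulnC -{2}(subnK le_tq) mulnDl.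
    by rewrite leq_add // leq_mul2l -ltnS ltn_ord orbT.
  by exists (Ordinal lt_wM); rewrite mulnC.
by exists (\col_i w i)%R => i; rewrite mxE.
Qed.

(** Box coordinates are shifted by N, so that the lattice points of the cube
    [-N, N]^n form a finite type on which residues are those of naturals. *)
Definition box_point (n N : nat) (x : 'cV['I_N.*2.+1]_n) : 'cV[int]_n :=
  (\col_i ((x i ord0)%:Z - N%:Z))%R.

Lemma box_point_inj n N : injective (@box_point n N).
Proof.
move=> x y /colP exy; apply/colP=> i; apply: val_inj.
by have := exy i; rewrite !mxE => /addIr[].
Qed.

Lemma box_point_onto n N (u : 'cV[int]_n) :
  (forall i, `|u i ord0|%N <= N) -> exists x, @box_point n N x = u.
Proof.
move=> le_uN; exists (\col_i inord `|(u i ord0 + N%:Z)%R|%N)%R.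
apply/colP=> i; rewrite !mxE; have : `|u i 0%R|%N <= N := le_uN i.
move: (u i _) => v le_vN.
rewrite inordK; last by rewrite ltnS -addnn; lia.
by rewrite gez0_abs ?addrK //; lia.
Qed.

Lemma box_point_barycenter n N q s t (w x y : 'cV['I_N.*2.+1]_n) :
  q = s + t ->
  (forall i, q * w i ord0 = s * x i ord0 + t * y i ord0) ->
  (box_point w *+ q = box_point x *+ s + box_point y *+ t)%R.
Proof.
move=> eq wP; apply/colP=> i; rewrite !mxE !mulmxnE !mxE.
have := wP i; move: (w i _) (x i _) (y i _) => c a b /(congr1 Posz).
rewrite eq PoszM !PoszD !PoszM => abc.
rewrite -[LHS]mulr_natl -[X in _ = (X + _)%R]mulr_natl.
rewrite -[X in _ = (_ + X)%R]mulr_natl !natz PoszD mulrBr abc; ring.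
Qed.

Lemma linear_form_barycenter (R : realDomainType) (m n : nat) (A : 'M[R]_(m, n))
  (i : 'I_m) (q s t : nat) (u v w : 'cV[int]_n) :
  (u *+ q = v *+ s + w *+ t)%R ->
  let f x := (A *m map_mx intr x)%R i ord0 in
  (q%:R * f u = s%:R * f v + t%:R * f w)%R.
Proof.
move=> e f; rewrite /f.
have := congr1 (fun x : 'cV[int]_n =>
  (A *m map_mx (intr : int -> R) x)%R i ord0) e.
rewrite raddfD /= !raddfMn /= mulmxDr !(raddfMn (mulmx A)) /= !mxE !mulmxnE.
by rewrite !mulr_natl !mxE.
Qed.

(** The pigeonhole step: the private points of distinct rows lie in distinct
    classes modulo k + 2, of which there are (k + 2) ^ n. *)
Lemma card_minimal_system (R : realType) (m n k : nat) (A : 'M[R]_(m, n))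
    (b : 'cV[R]_m) (S : {set 'I_m}) :
  ~ more_than k (integer_solutions A b S) ->
  (forall i, i \in S -> more_than k (integer_solutions A b (S :\ i))) ->
  #|S| <= k.+2 ^ n.
Proof.
move=> few many.
pose I := {i : 'I_m | i \in S}.
have /fin_all_exists[g gP] (i : I) : exists g : 'I_k.+1 -> 'cV[int]_n,
    injective g /\ forall t, integer_solutions A b (S :\ val i) (g t).
  by apply/more_thanP/many/valP.
pose N := \max_(i : I) \max_t \max_j `|g i t j ord0|%N.
pose F := 'cV['I_N.*2.+1]_n.
pose f (i : I) (x : F) := (A *m map_mx intr (box_point x))%R (val i) ord0.
pose beta (i : I) := b (val i) ord0.
have [||z [le_k zP]] := @exists_private_points R I F k f beta.
- rewrite leqNgt; apply/negP=> /card_gtP[h [h_inj hP]]; apply: few.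
  apply/more_thanP; exists (@box_point n N \o h); split.
    by move=> s t /box_point_inj /h_inj.
  by move=> t i Si; have := hP t; rewrite inE => /forallP/(_ (exist _ i Si)).
- move=> i; apply/card_gtP; have [g_inj gS] := gP i.
  have /fin_all_exists[h hP] t : exists x : F, box_point x = g i t.
    apply: box_point_onto => j.
    rewrite /N; apply: leq_trans (leq_bigmax i); apply: leq_trans (leq_bigmax t).
    exact: (leq_bigmax j).
  exists h; split=> [s t est | t].
    by apply: g_inj; rewrite -!hP est.
  rewrite inE; apply/forall_inP=> j nji; rewrite /f hP; apply: gS.
  by rewrite !inE (valP j) andbT; apply: contra nji => /eqP/val_inj->.
rewrite leqNgt; apply/negP=> gt_S.
pose residue (x : F) : 'cV['I_k.+2]_n := (\col_j inord (x j ord0 %% k.+2))%R.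
have /injectivePn[i [j nij eij]] : ~~ injectiveb (residue \o z).
  apply/negP=> /injectiveP/leq_card.
  by rewrite card_mx card_ord muln1 card_sig leqNgt gt_S.
have congr_ij l : z i l ord0 = z j l ord0 %[mod k.+2].
  have /matrixP/(_ l ord0) := eij; rewrite !mxE => /(congr1 val).
  by rewrite /= !inordK ?ltn_pmod.
have /fin_all_exists[w wP] (t : 'I_k.+1) : exists w : F, forall l,
    k.+2 * w l ord0 = (k.+2 - t.+1) * z i l ord0 + t.+1 * z j l ord0.
  by apply: lattice_points_on_segment => //; apply: ltnW; rewrite ltnS.
move: le_k; rewrite leqNgt => /negP; apply; apply/card_gtP.
have nji : j != i by rewrite eq_sym.
exists w; split=> [s t est | t].
  have nz_ij : z i != z j.
    by apply/eqP=> zij; have := zP i j nji; rewrite zij ltxx.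
  have [l nl] : exists l, z i l ord0 <> z j l ord0.
    apply/existsNP => eq_ij; case/eqP: nz_ij.
    by apply/matrixP=> l c; rewrite ord1.
  have {}nl : val (z i l ord0) <> val (z j l ord0) by move/val_inj.
  apply: val_inj; have := wP s l; rewrite est wP.
  have := ltn_ord s; have := ltn_ord t; move: nl; move=> /=; nia.
rewrite inE; apply/forallP=> l.
have : (k.+2%:R * f l (w t) =
    (k.+2 - t.+1)%:R * f l (z i) + t.+1%:R * f l (z j))%R.
  apply/linear_form_barycenter/box_point_barycenter; last exact: wP.
  by rewrite subnK // ltnS ltnW.
rewrite natrB; last by rewrite ltnS ltnW.
have k2_gt0 : (0 < k.+2%:R :> R)%R by rewrite ltr0n.
rewrite -(ltr_pM2l k2_gt0) => ->.
have t_gt0 : (0 < t.+1%:R :> R)%R by rewrite ltr0n.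
have : (0 < k.+2%:R - t.+1%:R :> R)%R by rewrite subr_gt0 ltr_nat ltnS.
(* At most one end of the segment is on the boundary of constraint l: that end is
   z i if l = i, and z j if l = j. *)
set d := (_ - _)%R => d_gt0.
have le_zi : (f l (z i) <= f l (z l))%R.
  by have [-> // | /(zP i l)/ltW] := eqVneq l i.
have le_zj : (f l (z j) <= f l (z l))%R.
  by have [-> // | /(zP j l)/ltW] := eqVneq l j.
have -> : (k.+2%:R = d + t.+1%:R :> R)%R by rewrite subrK.
rewrite [ltRHS]mulrDl; have [eli | /(zP i l) lt_zi] := eqVneq l i.
  by rewrite ler_ltD ?ler_pM2l ?ltr_pM2l // eli zP.
by rewrite ltr_leD ?ler_pM2l ?ltr_pM2l.
Qed.

(* A system with fewer than c constraints has no c-element subset: the subset of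
   cardinality minn c m is then the whole system. *)
Theorem corollary2 (n k : nat) :
  exists c : nat,
    forall (R : realType) (m : nat) (A : 'M[R]_(m, n)) (b : 'cV[R]_m),
      (forall S : {set 'I_m}, #|S| = minn c m ->
         more_than k (integer_solutions A b S)) ->
      more_than k (integer_solutions A b [set: 'I_m]).
Proof.
exists (k.+2 ^ n) => R m A b all_small.
have sol_sub (S T : {set 'I_m}) : S \subset T ->
    more_than k (integer_solutions A b T) ->
    more_than k (integer_solutions A b S).
  move=> /fintype.subsetP sST /card_le_trans; apply.
  by apply: subset_card_le => x solT i /sST; apply: solT.
apply: contrapT => few.
pose Few (S : {set 'I_m}) := ~~ `[< more_than k (integer_solutions A b S) >].
have [S /minsetP[/asboolPn fewS minS] _] :
    {S : {set 'I_m} | minset Few S & S \subset [set: _]}.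
  by apply: minset_exists; apply/asboolPn.
have leS : #|S| <= k.+2 ^ n.
  apply: (card_minimal_system fewS) => i Si; apply: contrapT => fewSi.
  have /setP/(_ i) : S :\ i = S by apply: minS; [apply/asboolPn | apply: subD1set].
  by rewrite !inE eqxx Si.
apply: fewS.
have [||T sST cT] := @exists_superset_card _ S (minn (k.+2 ^ n) m).
- by rewrite leq_min leS -[m in _ <= m]card_ord max_card.
- by rewrite card_ord geq_minr.
exact: sol_sub sST (all_small T cT).
Qed.
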